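(* Let $(X,T)$ be a t.d.s. Each of the following conditions implies that $(X,T)$ is mean sensitive: (i) $(X,T)$ is topologically mixing, uniquely ergodic and has positive topological entropy; (ii) $(X,T)$ is non-trivial (i.e. $X$ has more than one point), minimal and topologically weakly mixing; (iii) $(X,T)$ is transitive, has the shadowing property and has positive topological entropy.
   Context: A t.d.s. (topological dynamical system) is a pair $(X,T)$ where $X$ is a non-empty compact metric space with metric $d$ and $T\colon X\to X$ is continuous; $\mathbb{N}$ denotes the positive integers and $\mathbb{Z}_+$ the non-negative integers. $(X,T)$ is transitive if for all non-empty open $U,V\subset X$ there is $n\in\mathbb{N}$ with $T^nU\cap V\neq\emptyset$; topologically mixing if for all non-empty open $U,V\subset X$ we have $T^nU\cap V\neq\emptyset$ for all sufficiently large $n$; (topologically) weakly mixing if $(X\times X,T\times T)$ is transitive; minimal if every point of $X$ has dense forward orbit; uniquely ergodic if it has exactly one $T$-invariant Borel probability measure. A sequence $\{x_n\}_{n=0}^\infty$ in $X$ is a $\delta$-pseudo-orbit for $T$ if $d(x_{n+1},Tx_n)<\delta$ for all $n\in\mathbb{Z}_+$, and it is $\varepsilon$-traced by $x\in X$ if $d(T^nx,x_n)<\varepsilon$ for all $n\in\mathbb{Z}_+$. $(X,T)$ has the shadowing property if for every $\varepsilon>0$ there is $\delta>0$ such that each $\delta$-pseudo-orbit for $T$ is $\varepsilon$-traced by some point of $X$. $(X,T)$ is mean sensitive if there is $\delta>0$ such that for every non-empty open $U\subset X$ there are $x,y\in U$ with $\limsup_{n\to\infty}\frac1n\sum_{i=0}^{n-1}d(T^ix,T^iy)>\delta$.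 *)

(* Defs.v *)
From HB Require Import structures.
From mathcomp Require Import all_boot all_order all_algebra finmap.
From mathcomp Require Import all_classical all_reals all_analysis.

Set Implicit Arguments.
Unset Strict Implicit.
Unset Printing Implicit Defensive.

Import Order.TTheory GRing.Theory Num.Theory.
Import numFieldNormedType.Exports.

Local Open Scope classical_set_scope.
Local Open Scope ring_scope.

(* The distinguished point is how the library says that a space is non-empty;
   it also puts the sigma-algebra generated by a family of sets on the space. *)
#[short(type="pointedMetricType")]
HB.structure Definition PointedMetric (K : numDomainType) :=
  {M of Metric K M & Pointed M}.

Section TopologicalNotions.
Variables (X : topologicalType) (T : X -> X).

Definition transitive_tds :=
  forall U V : set X, open U -> U !=set0 -> open V -> V !=set0 ->
    exists n : nat, (0 < n)%N /\ (iter n T @` U) `&` V !=set0.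

Definition topologically_mixing :=
  forall U V : set X, open U -> U !=set0 -> open V -> V !=set0 ->
    \forall n \near \oo, (iter n T @` U) `&` V !=set0.

Definition minimal_tds :=
  forall x : X, dense [set iter n T x | n in [set: nat]].

End TopologicalNotions.

Definition weakly_mixing (X : topologicalType) (T : X -> X) :=
  transitive_tds (fun p : X * X => (T p.1, T p.2)).

Section UniqueErgodicity.
Variables (R : realType) (X : pointedMetricType R) (T : X -> X).

Definition borel := g_sigma_algebraType (@open X).

Definition invariant_measure (mu : probability borel R) :=
  forall A : set borel, measurable A -> mu (T @^-1` A) = mu A.

(* A library measure is a function on all subsets, whose values outside the
   sigma-algebra are arbitrary: two measures are the same when they agree on
   the measurable sets. *)
Definition uniquely_ergodic :=
  exists2 mu : probability borel R, invariant_measure mu &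
    forall nu : probability borel R, invariant_measure nu ->
      forall A : set borel, measurable A -> nu A = mu A.

End UniqueErgodicity.

Section MetricNotions.
Variables (R : realType) (X : metricType R) (T : X -> X).

Definition pseudo_orbit (delta : R) (x_ : nat -> X) :=
  forall n, mdist (x_ n.+1) (T (x_ n)) < delta.

Definition traced (eps : R) (x_ : nat -> X) (x : X) :=
  forall n, mdist (iter n T x) (x_ n) < eps.

Definition shadowing :=
  forall eps : R, 0 < eps ->
    exists2 delta : R, 0 < delta &
      forall x_ : nat -> X, pseudo_orbit delta x_ ->
        exists x : X, traced eps x_ x.

(* Bowen's definition of topological entropy:
   lim_{eps -> 0+} limsup_n (1/n) log s_n(eps), with s_n(eps) the maximal
   cardinality of an (n, eps)-separated set. *)
Definition orbit_separated (n : nat) (eps : R) (A : {fset X}) :=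
  forall x y, x \in A -> y \in A -> x != y ->
    exists2 i : nat, (i < n)%N & eps < mdist (iter i T x) (iter i T y).

Definition max_separated (n : nat) (eps : R) : \bar R :=
  ereal_sup [set (#|` A|%:R)%:E | A in [set A | orbit_separated n eps A]].

Definition entropy_at (eps : R) : \bar R :=
  limn_esup (fun n : nat => (n%:R^-1)%:E * lne (max_separated n eps))%E.

Definition topological_entropy : \bar R :=
  lim (entropy_at eps @[eps --> 0^'+]).

Definition mean_sensitive :=
  exists2 delta : R, 0 < delta &
    forall U : set X, open U -> U !=set0 ->
      exists x y : X, [/\ U x, U y &
        (delta%:E < limn_esup (fun n : nat =>
           (n%:R^-1 * \sum_(i < n) mdist (iter i T x) (iter i T y))%:E))%E].

End MetricNotions.

(* Main.v *)
Require Import Defs.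
From HB Require Import structures.
From mathcomp Require Import all_boot all_order all_algebra finmap.
From mathcomp Require Import all_classical all_reals all_analysis.
From mathcomp Require Import ring lra zify.

(** Call two points close in mean when the averages of the distances between
    their orbits are eventually small.  If the system is not mean sensitive, then
    for every [d > 0] some non-empty open set [U] consists of points that are
    pairwise [d]-close in mean ([not_mean_sensitive]).  Each case contradicts this
    for a suitable [d].

    Under (i) and (ii) every non-empty open [U] has two consecutive return times
    [n] and [n + 1].  Going through a point of [U] that comes back to [U], this makes
    [T x] close in mean to [x] for [x] in [U], and so [T] has a fixed point [p]
    ([fixed_point_of_not_mean_sensitive]).  A minimal system with a fixed point is a
    single point, which settles (ii).

    Positive entropy enters (i) and (iii) through one statement
    ([positive_entropy_mean_separated]): there is [d > 0] such that, for any finite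
    set of colours and for arbitrarily large [n], every colouring of [X] has two points
    of one colour whose orbit segments of length [n] are at mean distance more than
    [d].  The reason is that the number of orbit segments that can be told apart at
    a fixed scale grows exponentially, whereas a ball of small radius in the mean
    metric contains few of them; the latter is a weighted count of words with few
    letters that are not blank ([hamming_ball_size]).

    For (iii), transitivity gives chains of bounded length between any two points.
    Colour each point [p] by the lengths of a chain from a fixed [z] in [U] to [p] and
    of one from [T^n p] back to [z].  Two points of one colour that are far apart in
    mean over [n] steps give two closed pseudo-orbits through [z] with the same period;
    they are traced by two points of [U] which remain far apart in mean for ever
    ([shadowing_mean_sensitive]).

    For (i), the Dirac mass at [p] is invariant.  With a single colour, the same
    statement gives arbitrarily long orbit segments that stay away from [p] in mean,
    and a limit of their empirical measures is an invariant probability other than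
    the Dirac mass, against unique ergodicity ([exists_invariant_measure_away]).  The
    limit is taken along an ultrafilter, which gives a finitely additive invariant
    probability on all subsets; the infimum of the sums of its values over countable
    open covers is an outer measure for which the open sets are measurable
    ([caratheodory_open]), and whose restriction to the Borel sets is the required
    measure ([borel_regularization]). *)

Set Implicit Arguments.
Unset Strict Implicit.
Unset Printing Implicit Defensive.

Import Order.TTheory GRing.Theory Num.Theory.
Import numFieldNormedType.Exports.
Import metricType_numDomainType.

Local Open Scope classical_set_scope.
Local Open Scope ring_scope.

(** * Upper limits of sequences *)

Section LimsupSequences.
Context {R : realType}.
Implicit Type u : nat -> \bar R.

Lemma limn_esup_lt_near u (b : \bar R) : (limn_esup u < b)%E ->
  exists N, forall n, (N <= n)%N -> (u n < b)%E.
Proof.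
rewrite /limn_esup limf_esupE => /ereal_inf_lt[_ [V [N _ NV] <-] Vb].
exists N => n Nn; apply: le_lt_trans Vb; apply: ereal_sup_ubound.
by exists n => //; exact: NV.
Qed.

Lemma limn_esup_gt_frequently u (b : \bar R) : (b < limn_esup u)%E ->
  forall N, exists2 n, (N <= n)%N & (b < u n)%E.
Proof.
move=> bu N; apply: contrapT => nex.
suff: (limn_esup u <= b)%E by rewrite leNgt bu.
rewrite /limn_esup limf_esupE; apply: ge_ereal_inf.
exists (ereal_sup (u @` [set n | (N <= n)%N])).
  by exists [set n | (N <= n)%N] => //; exists N.
apply: ge_ereal_sup => _ [n /= Nn <-]; rewrite leNgt; apply/negP => bun.
by apply: nex; exists n.
Qed.

End LimsupSequences.

(** * Compact metric spaces *)

Section CompactMetric.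
Context {R : realType} {X : pointedMetricType R}.
Hypothesis compactX : compact [set: X].

Lemma mdist_ballP (x : X) (e : R) y : ball x e y <-> mdist x y < e.
Proof. by rewrite ballEmdist. Qed.

Lemma open_mdist (U : set X) x : open U -> U x ->
  exists2 e : R, 0 < e & forall y, mdist x y < e -> U y.
Proof.
move=> oU Ux; have /nbhs_ballP[e /= e0 eU] := open_nbhs_nbhs (conj oU Ux).
by exists e => // y /mdist_ballP; exact: eU.
Qed.

Lemma open_mdist_ball (x : X) (e : R) : open [set y | mdist x y < e].
Proof.
rewrite openE => y /= xye; apply/nbhs_ballP; exists (e - mdist x y).
  by rewrite /= subr_gt0.
move=> z /mdist_ballP yz; rewrite /= (le_lt_trans (metric_triangle _ y _))//.
by rewrite addrC -ltrBrDr.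
Qed.

Lemma closed_mdist_ge (p : X) (c : R) : closed [set x | c <= mdist x p].
Proof.
rewrite -[X in closed X]setCK; apply: open_closedC.
rewrite (_ : ~` _ = [set x | mdist p x < c]); first exact: open_mdist_ball.
by apply/seteqP; split=> x /=; rewrite metric_sym ltNge => /negP.
Qed.

Lemma finite_net (r : R) : 0 < r ->
  exists (K : nat) (c : 'I_K -> X), forall x, exists i, mdist (c i) x < r.
Proof.
move=> r0; have := compactX; rewrite compact_cover.
move=> /(_ X setT (fun c => [set y | mdist c y < r])) [].
- by move=> c _; exact: open_mdist_ball.
- by move=> x _; exists x => //=; rewrite mdistxx.
move=> D _ Dc; exists (size D), (tnth (in_tuple D)) => x.
have [c /= cD cx] := Dc x I.
by have /tnthP[i ci] : c \in in_tuple D by []; exists i; rewrite -ci.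
Qed.

Lemma compact_mdist_lower_bound (T : X -> X) : continuous T ->
  (forall z, T z <> z) -> exists2 c : R, 0 < c & forall z, c <= mdist z (T z).
Proof.
move=> cT nofix.
have nearc : \forall c \near (0:R)^'+, [set: X] `<=`
    (fun c z => c <= mdist z (T z)) c.
  apply: (iffLR (compact_near_coveringP [set: X]) compactX _ _
    (fun c z => c <= mdist z (T z))) => x _.
  pose e := mdist x (T x) / 3.
  have d0 : 0 < mdist x (T x) by rewrite mdist_gt0; apply/eqP => /esym/nofix.
  have e0 : 0 < e by rewrite divr_gt0.
  near=> z c => /=.
  have xz : mdist x z < e by apply/mdist_ballP; near: z; exact: nbhsx_ballx.
  have TxTz : mdist (T x) (T z) < e.
    by near: z; apply: (cvgr_dist_lt _ e0); exact: cT.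
  have ce : c <= e by near: c; exact: nbhs_right_le.
  have h1 := metric_triangle x z (T x).
  have h2 := metric_triangle z (T z) (T x).
  move: h2; rewrite (metric_sym (T z)); move: ce xz TxTz; rewrite /e => *.
  lra.
have := @filterI _ _ (at_right_proper_filter _) _ _ (nbhs_right_gt (0 : R)) nearc.
move=> /filter_ex[c [c0 cX]]; exists c => // z; exact: cX.
Unshelve. all: by end_near. Qed.

Lemma compact_unif_continuous (T : X -> X) : continuous T ->
  forall e : R, 0 < e -> exists2 d : R, 0 < d &
    forall x y, mdist x y < d -> mdist (T x) (T y) < e.
Proof.
move=> cT e e0.
have neard : \forall d \near (0:R)^'+, [set: X] `<=`
    (fun d x => forall y, mdist x y < d -> mdist (T x) (T y) < e) d.
  apply: (iffLR (compact_near_coveringP [set: X]) compactX _ _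
    (fun d x => forall y, mdist x y < d -> mdist (T x) (T y) < e)) => x _.
  have e20 : 0 < e / 2 by rewrite divr_gt0.
  have /nbhs_ballP[r /= r0 rT] : nbhs x [set y | mdist (T x) (T y) < e / 2].
    by apply: (cvgr_dist_lt _ e20); exact: cT.
  have r20 : 0 < r / 2 by rewrite divr_gt0.
  near=> z d => /= y zy.
  have xz : mdist x z < r / 2 by apply/mdist_ballP; near: z; exact: nbhsx_ballx.
  have dr : d <= r / 2 by near: d; exact: nbhs_right_le.
  have xy : mdist x y < r by have := metric_triangle x z y; lra.
  have h1 : mdist (T x) (T y) < e / 2 by apply: rT; exact/mdist_ballP.
  have h2 : mdist (T x) (T z) < e / 2 by apply: rT; apply/mdist_ballP; lra.
  by have := metric_triangle (T z) (T x) (T y); rewrite (metric_sym (T z) (T x)); lra.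
have := @filterI _ _ (at_right_proper_filter _) _ _ (nbhs_right_gt (0 : R)) neard.
by move=> /filter_ex[d [d0 dX]]; exists d => // x y; exact: dX.
Unshelve. all: by end_near. Qed.

End CompactMetric.

(** * Mean distance of two orbits *)

Section OrbitSums.
Context {R : realType} {X : pointedMetricType R}.
Variable T : X -> X.

Definition orbit_dist (n : nat) (x y : X) : R :=
  \sum_(i < n) mdist (iter i T x) (iter i T y).

(** The statement that the upper mean distance of the two orbits is below
    [d], up to an arbitrarily small change of [d]; as a predicate it obeys a
    triangle inequality without any arithmetic of upper limits. *)
Definition mean_close (d : R) (x y : X) :=
  exists N, forall n, (N <= n)%N -> orbit_dist n x y <= d *+ n.

Lemma orbit_dist_sym n x y : orbit_dist n x y = orbit_dist n y x.
Proof. by apply: eq_bigr => i _; rewrite metric_sym. Qed.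

Lemma orbit_dist_triangle n x y z :
  orbit_dist n x z <= orbit_dist n x y + orbit_dist n y z.
Proof. by rewrite -big_split ler_sum// => i _; exact: metric_triangle. Qed.

Lemma orbit_dist_ge0 n x y : 0 <= orbit_dist n x y.
Proof. by rewrite sumr_ge0// => i _; exact: mdist_ge0. Qed.

Lemma orbit_dist_add m n x y : orbit_dist (m + n) x y =
  orbit_dist m x y + orbit_dist n (iter m T x) (iter m T y).
Proof.
rewrite /orbit_dist big_split_ord/=; congr (_ + _).
by apply: eq_bigr => i _; rewrite addnC !iterD.
Qed.

Lemma mean_close_sym d x y : mean_close d x y -> mean_close d y x.
Proof. by move=> [N Nd]; exists N => n /Nd; rewrite orbit_dist_sym. Qed.

Lemma mean_close_trans d e x y z :
  mean_close d x y -> mean_close e y z -> mean_close (d + e) x z.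
Proof.
move=> [N Nd] [M Me]; exists (maxn N M) => n; rewrite geq_max => /andP[Nn Mn].
rewrite (le_trans (orbit_dist_triangle _ _ y _))// mulrnDl.
by rewrite lerD// ?Nd// Me.
Qed.

(** Dropping the first [n] terms does not change an upper mean; the factor [2]
    pays for normalising by [m] a sum of [n + m] terms, once [n <= m]. *)
Lemma mean_close_iter d x y n : 0 <= d -> mean_close d x y ->
  mean_close (d *+ 2) (iter n T x) (iter n T y).
Proof.
move=> d0 [N Nd]; exists (maxn N n) => m; rewrite geq_max => /andP[Nm nm].
apply: (@le_trans _ _ (orbit_dist (n + m) x y)).
  by rewrite orbit_dist_add lerDr orbit_dist_ge0.
apply: le_trans (Nd _ (leq_trans Nm (leq_addl _ _))) _.
by rewrite -mulrnA mul2n -addnn ler_wpMn2l// leq_add2r.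
Qed.

Lemma not_mean_sensitive (d : R) : ~ mean_sensitive T -> 0 < d ->
  exists U : set X, [/\ open U, U !=set0 &
    forall x y, U x -> U y -> mean_close d x y].
Proof.
move=> nms d0; apply: contrapT => nU; apply: nms; exists (d / 2).
  by rewrite divr_gt0.
move=> U oU U0; apply: contrapT => nxy; apply: nU; exists U; split => // x y Ux Uy.
have /limn_esup_lt_near[N Nd] : (limn_esup (fun n : nat =>
    (n%:R^-1 * \sum_(i < n) mdist (iter i T x) (iter i T y))%:E) < d%:E)%E.
  apply: (@le_lt_trans _ _ (d / 2)%:E); last by rewrite lte_fin; lra.
  by rewrite leNgt; apply/negP => dxy; apply: nxy; exists x, y.
exists (maxn N 1) => n; rewrite geq_max => /andP[Nn n0].
have := Nd _ Nn; rewrite lte_fin ltr_pdivrMl ?ltr0n// => /ltW.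
by rewrite mulr_natl.
Qed.

End OrbitSums.

(** * Consecutive return times force a fixed point *)

Section FixedPoint.
Context {R : realType} {X : pointedMetricType R}.
Variable T : X -> X.
Hypotheses (compactX : compact [set: X]) (continuousT : continuous T).

Definition hits (n : nat) (U : set X) := (iter n T @` U) `&` U !=set0.

(** Suppose that all points of [U] are [d]-close in mean and let [x] be in [U].
    A return time [n] of [U] yields [y] with both [y] and [T^n y] in [U], so that
    [x], [y], [T^n y] and [T^n x] are successively close in mean.  With two
    consecutive return times [n] and [n + 1], the point [T^(n+1) x] is close in mean
    both to [x] and to [T x].  Without fixed points compactness gives
    [c <= mdist z (T z)] for some [c > 0], hence [x] and [T x] are at mean distance
    at least [c], which is too much when [d] is small against [c]. *)
Lemma fixed_point_of_not_mean_sensitive :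
  (forall U : set X, open U -> U !=set0 -> exists n, hits n U /\ hits n.+1 U) ->
  ~ mean_sensitive T -> exists p, T p = p.
Proof.
move=> hit2 nms; apply: contrapT => nofix.
have [c c0 cT] : exists2 c : R, 0 < c & forall z, c <= mdist z (T z).
  by apply: compact_mdist_lower_bound => // z Tz; apply: nofix; exists z.
(* The triangle inequalities below add up to 4d + 8d = 12d, less than c. *)
pose d := c / 16; have d0 : 0 < d by rewrite divr_gt0.
have [U [oU [x Ux] Ud]] := not_mean_sensitive nms d0.
have [n [hn hSn]] := hit2 U oU (ex_intro _ x Ux).
have return_close m : hits m U -> mean_close T (d *+ 4) x (iter m T x).
  move=> [_ [[y Uy <-] Uny]].
  rewrite (_ : d *+ 4 = d + (d + d *+ 2)); last by rewrite -!mulrS.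
  apply: (mean_close_trans (Ud _ _ Ux Uy)).
  apply: (mean_close_trans (Ud _ _ Uy Uny)).
  by apply: mean_close_iter; [exact: ltW|exact: Ud].
have := mean_close_iter 1 (mulrn_wge0 4 (ltW d0)) (return_close _ hn).
move=> /mean_close_sym; rewrite -iterD add1n => h.
have [N] := mean_close_trans (return_close _ hSn) h.
rewrite -mulrnA -mulrnDr => /(_ N.+1 (leqnSn _)).
apply/negP; rewrite -ltNge.
apply: (@lt_le_trans _ _ (c *+ N.+1)).
  by rewrite ltr_wMn2r// /d -mulr_natr; lra.
rewrite -[in leLHS](card_ord N.+1) -sumr_const ler_sum// => i _.
by rewrite /= -iterSr iterS.
Qed.

Lemma mixing_hits : topologically_mixing T ->
  forall U : set X, open U -> U !=set0 -> exists n, hits n U /\ hits n.+1 U.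
Proof.
move=> mT U oU U0; have [N _ NU] := mT U U oU U0 oU U0.
by exists N; split; apply: NU => /=.
Qed.

End FixedPoint.

(** * Minimal weakly mixing systems *)

Section MinimalWeaklyMixing.
Context {R : realType} {X : pointedMetricType R}.
Variable T : X -> X.
Hypotheses (compactX : compact [set: X]) (continuousT : continuous T).

Lemma minimal_fixed_point (p : X) : minimal_tds T -> T p = p -> forall x, x = p.
Proof.
move=> minT Tp x.
have iterp n : iter n T p = p by elim: n => // n /= ->.
apply: contrapT => /eqP xp; have d0 : 0 < mdist x p by rewrite mdist_gt0.
have B0 : [set y | mdist x y < mdist x p] !=set0.
  by exists x; rewrite /= mdistxx.
have [z [/= xz [n _ nz]]] := minT p _ B0 (open_mdist_ball _ _).
by move: xz; rewrite -nz iterp ltxx.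
Qed.

Lemma open_setX (U V : set X) : open U -> open V -> open (U `*` V).
Proof.
move=> oU oV; rewrite openE => -[a b] [/= Ua Vb]; exists (U, V) => //.
by split; apply: open_nbhs_nbhs.
Qed.

(** The orbit of [T x] is dense, and each of its points has a preimage. *)
Lemma minimal_preimage_neq0 (U : set X) :
  minimal_tds T -> open U -> U !=set0 -> T @^-1` U !=set0.
Proof.
move=> minT oU [x Ux].
have [y [Uy [n _ ny]]] := minT (T x) U (ex_intro _ x Ux) oU.
by exists (iter n T x); rewrite /= -iterS iterSr ny.
Qed.

(** One transition of the square from [U * U] to [U * T^-1 U] gives the return
    times [n] and [n + 1] at once. *)
Lemma weakly_mixing_hits : minimal_tds T -> weakly_mixing T ->
  forall U : set X, open U -> U !=set0 -> exists n, hits T n U /\ hits T n.+1 U.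
Proof.
move=> minT wm U oU U0.
have [y Uy] := minimal_preimage_neq0 minT oU U0; have [x Ux] := U0.
have oV : open (U `*` T @^-1` U).
  by apply: open_setX => //; apply: open_comp => // z _; exact: continuousT.
have [n [_ [w [[[a b] /= [Ua Ub] ew] Vw]]]] :=
  wm (U `*` U) (U `*` T @^-1` U) (open_setX oU oU) (ex_intro _ (x, x) (conj Ux Ux))
     oV (ex_intro _ (x, y) (conj Ux Uy)).
have iter_pair : iter n (fun p : X * X => (T p.1, T p.2)) (a, b) =
    (iter n T a, iter n T b).
  by elim: n {ew} => //= n ->.
move: Vw; rewrite -ew iter_pair => -[/= Una UTnb]; exists n; split.
  by exists (iter n T a); split => //; exists a.
by exists (iter n.+1 T b); split => //; exists b.
Qed.

Lemma minimal_weakly_mixing_mean_sensitive :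
  (exists x y : X, x <> y) -> minimal_tds T -> weakly_mixing T -> mean_sensitive T.
Proof.
move=> [x [y xy]] minT wm; apply: contrapT => nms.
have [p Tp] := fixed_point_of_not_mean_sensitive compactX continuousT
  (weakly_mixing_hits minT wm) nms.
by apply: xy; rewrite (minimal_fixed_point minT Tp x) (minimal_fixed_point minT Tp y).
Qed.

End MinimalWeaklyMixing.

(** * Positive entropy and mean separation *)

Section Entropy.
Context {R : realType} {X : pointedMetricType R}.
Variable T : X -> X.

Lemma max_separated_ge1 n (e : R) : (1 <= max_separated T n e)%E.
Proof.
apply: ereal_sup_ubound; exists [fset point]%fset; last by rewrite cardfs1.
by move=> x y; rewrite !inE => /eqP -> /eqP ->; rewrite eqxx.
Qed.

Lemma entropy_at_ge0 (e : R) : (0 <= entropy_at T e)%E.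
Proof.
apply: limf_esup_ge0 => [[N _ /(_ N (leqnn N))]//|n].
by rewrite mule_ge0 ?lee_fin ?invr_ge0 ?ler0n// lne_ge0 max_separated_ge1.
Qed.

(** As [entropy_at] is non-negative, it is positive at some scale [e]: if it
    vanished at all scales, so would its limit. *)
Lemma positive_entropy_separated : (0 < topological_entropy T)%E ->
  exists e h : R, [/\ 0 < e, 0 < h & forall N, exists n (A : {fset X}),
    [/\ (N <= n)%N, orbit_separated T n e A & expR (h * n%:R) < #|` A|%:R]].
Proof.
move=> hpos.
have [e e0 ent0] : exists2 e : R, 0 < e & (0 < entropy_at T e)%E.
  apply: contrapT => nex; move: hpos; rewrite /topological_entropy.
  rewrite (_ : lim _ = 0%E) ?ltxx//; apply: cvg_lim => //.
  apply: cvg_near_cst; near=> e.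
  have e0 : 0 < e by near: e; exact: nbhs_right_gt.
  apply/eqP; rewrite eq_le entropy_at_ge0 andbT leNgt.
  by apply/negP => ent0; apply: nex; exists e.
have [h h0 hent] : exists2 h : R, 0 < h & (h%:E < entropy_at T e)%E.
  case: (entropy_at T e) ent0 => [r| |//]; last by exists 1; rewrite ?ltry.
  by rewrite lte_fin => r0; exists (r / 2); rewrite ?lte_fin; lra.
exists e, h; split=> // N.
have [n Nn] := limn_esup_gt_frequently hent (maxn N 1).
move: Nn; rewrite geq_max => /andP[Nn n0].
have nR0 : 0 < n%:R :> R by rewrite ltr0n.
rewrite lte_pdivlMl// -EFinM => hn.
have [_ [A sepA <-]] : exists2 y,
    [set (#|` A|%:R)%:E | A in [set A | orbit_separated T n e A]] y &
    ((expR (h * n%:R))%:E < y)%E.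
  apply: ereal_sup_gt; rewrite -[ltLHS]/(expeR (h * n%:R)%:E).
  rewrite -[ltRHS](@lneK R) ?lte_expeR 1?mulrC//.
  by rewrite in_itv/= leey andbT (le_trans _ (max_separated_ge1 n e)).
by rewrite lte_fin => hA; exists n, A.
Unshelve. all: by end_near. Qed.

(** A separated set inside a ball of the mean metric is small.  Code [b] by the
    word whose [i]-th letter is a blank when [T^i b] is near [T^i a], and
    otherwise the index of a net point near [T^i b].  Separated points have
    different words, and a word of a point close in mean to [a] has few letters
    that are not blank.  Such words are counted with weights: a blank weighs
    [1], any other letter [expR (- s)].  All words together weigh
    [(1 + K * expR (- s)) ^+ n], while each word of [B] weighs at least
    [expR (- (s * (2 / e) * d * n))], because a letter other than a blank at place [i] costs
    [mdist (T^i a) (T^i b) >= e / 2].  The parameter [s] is free. *)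
Lemma hamming_ball_size (n K : nat) (c : 'I_K -> X) (e s d : R) (a : X)
    (B : seq X) : 0 < e -> 0 <= s -> uniq B ->
  (forall x, exists i, mdist (c i) x < e / 2) ->
  (forall x y, x \in B -> y \in B -> x != y ->
    exists2 i, (i < n)%N & e < mdist (iter i T x) (iter i T y)) ->
  (forall b, b \in B -> orbit_dist T n a b <= d *+ n) ->
  (size B)%:R <= expR ((K%:R * expR (- s) + s * (2 / e) * d) * n%:R).
Proof.
move=> e0 s0 uB net sepB closeB.
have e20 : 0 < e / 2 by rewrite divr_gt0.
have [cell cellP] := choice net.
pose dst b (i : 'I_n) := mdist (iter i T a) (iter i T b).
pose word b : {ffun 'I_n -> 'I_K.+1} :=
  [ffun i => if dst b i < e / 2 then ord0 else lift ord0 (cell (iter i T b))].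
pose wt (j : 'I_K.+1) : R := if j == ord0 then 1 else expR (- s).
have wt_ge0 j : 0 <= wt j by rewrite /wt; case: ifP => // _; exact: expR_ge0.
have word_inj : {in B &, injective word}.
  move=> x y xB yB wxy; apply/eqP; apply: contrapT => /negP xy.
  have [i ni] := sepB _ _ xB yB xy; apply/negP; rewrite -leNgt.
  have := congr1 (fun w : {ffun 'I_n -> 'I_K.+1} => w (Ordinal ni)) wxy.
  rewrite !ffunE /dst/=; case: ifPn => hx; case: ifPn => hy.
  - move=> _; have := metric_triangle (iter i T x) (iter i T a) (iter i T y).
    by rewrite (metric_sym (iter i T x) (iter i T a)); lra.
  - by move/eqP; rewrite eqE/=.
  - by move/eqP; rewrite eqE/=.
  - move=> /lift_inj cxy.
    have := metric_triangle (iter i T x) (c (cell (iter i T x))) (iter i T y).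
    have := cellP (iter i T y); have := cellP (iter i T x); rewrite -cxy.
    by rewrite (metric_sym (iter i T x) (c _)); lra.
have weight_ge b : b \in B ->
    expR (- (s * (2 / e) * d * n%:R)) <= \prod_(i < n) wt (word b i).
  move=> /closeB bB.
  apply: (@le_trans _ _ (expR (\sum_(i < n) - (s * (2 / e) * dst b i)))).
    rewrite ler_expR sumrN lerN2 -mulr_sumr -[leRHS]mulrA.
    by rewrite ler_wpM2l ?mulr_natr ?mulr_ge0 ?invr_ge0 ?(ltW e0).
  rewrite expR_sum ler_prod// => i _; rewrite expR_ge0/= ffunE /wt.
  case: ltP => hb; rewrite ?eqxx.
    by rewrite -[leRHS]expR0 ler_expR oppr_le0 !mulr_ge0 ?mdist_ge0 ?invr_ge0 ?(ltW e0).
  rewrite ler_expR lerN2 -mulrA ler_peMr//.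
  by rewrite mulrAC ler_pdivlMr// mul1r mulrC -ler_pdivrMr.
have sum_weight : \sum_(b <- B) \prod_(i < n) wt (word b i) <=
    (1 + K%:R * expR (- s)) ^+ n.
  rewrite (_ : _ ^+ n = \sum_(w : {ffun 'I_n -> 'I_K.+1}) \prod_i wt (w i)).
    rewrite -(big_map word xpredT (fun w : {ffun _} => \prod_i wt (w i))).
    rewrite big_uniq ?map_inj_in_uniq//.
    rewrite [leRHS](bigID [in map word B])/= lerDl.
    by rewrite sumr_ge0// => w _; rewrite prodr_ge0.
  rewrite -(bigA_distr_bigA (fun=> wt)) big_const_ord iter_mulr_1.
  congr (_ ^+ _); rewrite big_ord_recl /wt eqxx; congr (_ + _).
  by rewrite (eq_bigr (fun=> expR (- s)))// sumr_const card_ord mulr_natl.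
have : (size B)%:R * expR (- (s * (2 / e) * d * n%:R)) <=
    expR (K%:R * expR (- s) * n%:R).
  apply: (@le_trans _ _ (\sum_(b <- B) \prod_(i < n) wt (word b i))).
    rewrite mulr_natl -iter_addr_0 -count_predT -big_const_seq.
    by rewrite big_seq [leRHS]big_seq ler_sum.
  apply: le_trans sum_weight _; rewrite expRM_natr lerXn2r ?nnegrE ?expR_ge0//.
  by rewrite ?addr_ge0 ?mulr_ge0 ?expR_ge0 ?expR_ge1Dx.
by rewrite expRN ler_pdivrMr ?expR_gt0// -expRD -mulrDl.
Qed.

Hypothesis compactX : compact [set: X].

(** Positive entropy gives exponentially many separated points for infinitely
    many [n], whereas by [hamming_ball_size] a colour class whose points are all
    [d]-close in mean has at most [expR (h / 2 * n)] of them.  A fixed number of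
    colours therefore cannot suffice for large [n]. *)
Lemma positive_entropy_mean_separated : (0 < topological_entropy T)%E ->
  exists2 d : R, 0 < d & forall (F : finType) (N : nat),
    exists2 n, (N <= n)%N & forall col : X -> F,
      exists a b, col a = col b /\ d *+ n < orbit_dist T n a b.
Proof.
move=> /positive_entropy_separated[e [h [e0 h0 sep]]].
have e20 : 0 < e / 2 by rewrite divr_gt0.
have [K [c net]] := finite_net compactX e20.
(* With this s the weight of the letters, K * expR (- s) <= K / s, is at most
   h / 4, and the choice of d makes the other term of the bound equal to h / 4. *)
pose s := 4 * K%:R / h + 1.
have s1 : 1 <= s.
  by rewrite /s lerDr divr_ge0 ?mulr_ge0 ?ler0n ?(ltW h0).
have s0 : 0 < s by lra.
pose d := h * e / (8 * s); have d0 : 0 < d.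
  by rewrite divr_gt0 ?mulr_gt0 ?ltr0n.
exists d => // F N.
(* A length n beyond 2 * #|F| / h makes expR (h / 2 * n) exceed #|F|. *)
have [n [A [Nn sepA cardA]]] := sep (maxn N (Num.truncn (2 * #|F|%:R / h)).+1).
move: Nn; rewrite geq_max => /andP[Nn Fn]; exists n => // col.
apply: contrapT => nsep.
have bnd (k : F) :
    (size [seq x <- enum_fset A | col x == k])%:R <= expR (h / 2 * n%:R).
  case Bk : [seq x <- enum_fset A | col x == k] => [|a B]; first by rewrite expR_ge0.
  rewrite -Bk; set B' := [seq _ <- _ | _].
  have B'A x : x \in B' -> x \in A /\ col x = k.
    by rewrite mem_filter => /andP[/eqP].
  have := @hamming_ball_size n K c e s d a B' e0 (ltW s0) (filter_uniq _ (fset_uniq A)) net.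
  move=> /(_ _ _)/le_trans; apply.
  - by move=> x y /B'A[xA _] /B'A[yA _]; exact: sepA.
  - have /B'A[_ colak] : a \in B' by rewrite /B' Bk mem_head.
    move=> b /B'A[_ colbk]; rewrite leNgt; apply/negP => ab.
    by apply: nsep; exists a, b; rewrite colak colbk.
  rewrite ler_expR ler_wpM2r// (_ : s * (2 / e) * d = h / 4); last first.
    by rewrite /d; field; rewrite !gt_eqF.
  suff : K%:R * expR (- s) <= h / 4 by lra.
  rewrite expRN ler_pdivrMr ?expR_gt0//.
  have es : s <= expR s by have := expR_ge1Dx s; lra.
  apply: (@le_trans _ _ (h / 4 * s)); last by rewrite ler_wpM2l// divr_ge0// ltW.
  rewrite (_ : h / 4 * s = K%:R + h / 4); last by rewrite /s; field; rewrite gt_eqF.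
  by rewrite lerDl divr_ge0 ?ltW.
have : #|` A|%:R <= #|F|%:R * expR (h / 2 * n%:R).
  rewrite -sum1_size natr_sum (partition_big col predT)//=.
  rewrite mulr_natl -sumr_const ler_sum// => k _.
  by rewrite -natr_sum sum1_count -size_filter; exact: bnd.
apply/negP; rewrite -ltNge; apply: le_lt_trans cardA.
rewrite (_ : h * n%:R = h / 2 * n%:R + h / 2 * n%:R); last by field.
rewrite expRD ler_wpM2r ?expR_ge0//.
apply: le_trans (expR_ge1Dx _).
have : 2 * #|F|%:R / h <= n%:R.
  by rewrite ltW// (lt_le_trans (truncnS_gt _))// ler_nat.
rewrite ler_pdivrMr//; lra.
Qed.

End Entropy.

(** * Shadowing: tracing closed pseudo-orbits *)

Section Shadowing.
Context {R : realType} {X : pointedMetricType R}.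
Variable T : X -> X.

Definition chain (delta : R) (n : nat) (w : nat -> X) (u v : X) :=
  [/\ w 0%N = u, w n = v &
    forall i, (i < n)%N -> mdist (w i.+1) (T (w i)) < delta].

(** The bound [M] is uniform in [u] and [v]: finitely many true orbit segments
    join any two balls of a finite net, and changing only their end points into
    [u] and [v] costs an error controlled by uniform continuity. *)
Lemma transitive_chains : compact [set: X] -> continuous T -> transitive_tds T ->
  forall delta : R, 0 < delta -> exists M, forall u v,
    exists (n : 'I_M.+1) (w : nat -> X), (0 < n)%N /\ chain delta n w u v.
Proof.
move=> compactX cT trT delta delta0.
have delta20 : 0 < delta / 2 by lra.
have [r r0 rT] := compact_unif_continuous compactX cT delta20.
pose e := Num.min r (delta / 2) / 2.
have e0 : 0 < e by rewrite /e divr_gt0// lt_min r0.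
have er : e + e <= r by rewrite /e -splitr ge_min lexx.
have ed : e + e <= delta / 2 by rewrite /e -splitr ge_min lexx orbT.
have [K [c net]] := finite_net compactX e0.
have link (ij : 'I_K * 'I_K) : exists nz : nat * X, [/\ (0 < nz.1)%N,
    mdist (c ij.1) nz.2 < e & mdist (c ij.2) (iter nz.1 T nz.2) < e].
  have B0 i : [set y | mdist (c i) y < e] !=set0.
    by exists (c i); rewrite /= mdistxx.
  have [n [n0 [w [[z cz zw] cw]]]] := trT _ _ (open_mdist_ball (c ij.1) e)
    (B0 _) (open_mdist_ball (c ij.2) e) (B0 _).
  by exists (n, z); rewrite /= zw.
have [f fP] := choice link.
exists (\max_ij (f ij).1) => u v.
have [i iu] := net u; have [j jv] := net v.
have [n0 cz cw] := fP (i, j); have fij := @leq_bigmax _ (fun ij => (f ij).1) (i, j).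
exists (Ordinal (fij : ((f (i, j)).1 < _.+1)%N)), (fun k =>
  if k == 0%N then u else
  if (k < (f (i, j)).1)%N then iter k T (f (i, j)).2 else v).
rewrite /=; move: (f (i, j)) n0 cz cw {fij} => [n z] /= n0 cz cw.
split=> //; split=> //; first by rewrite ltnn gtn_eqF.
move=> k kn /=; rewrite kn.
apply: le_lt_trans (metric_triangle _ (iter k.+1 T z) _) _.
rewrite (splitr delta) ltrD//.
  case: ltnP => nk; first by rewrite mdistxx.
  have -> : k.+1 = n by apply/eqP; rewrite eqn_leq kn.
  have := metric_triangle v (c j) (iter n T z).
  by rewrite (metric_sym v (c j)); lra.
case: ifPn => [/eqP -> /=|_]; last by rewrite iterS mdistxx.
apply: rT; have := metric_triangle z (c i) u.
by rewrite (metric_sym z (c i)); lra.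
Qed.

Lemma pseudo_orbit_periodic (delta : R) (P : nat) (w : nat -> X) (u : X) :
  (0 < P)%N -> chain delta P w u u -> pseudo_orbit T delta (fun k => w (k %% P)%N).
Proof.
move=> P0 [w0 wP wT] k; have kP := ltn_pmod k P0.
suff -> : w (k.+1 %% P)%N = w (k %% P).+1 by exact: wT.
rewrite -addn1 -modnDml addn1; have := kP; rewrite leq_eqVlt.
by case/predU1P => [->|/modn_small-> //]; rewrite modnn w0 wP.
Qed.

Definition loop (r n : nat) (v w : nat -> X) (p : X) (k : nat) : X :=
  if (k < r)%N then v k else
  if (k < r + n)%N then iter (k - r) T p else w (k - (r + n))%N.

Lemma loop_orbit r n v w p k : (k < n)%N -> loop r n v w p (r + k) = iter k T p.
Proof.
by move=> kn; rewrite /loop ifF ?ifT; [rewrite addKn|lia|lia].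
Qed.

Lemma chain_loop (delta : R) (r n s : nat) (v w : nat -> X) (z p : X) :
  0 < delta -> (0 < r)%N ->
  chain delta r v z p -> chain delta s w (iter n T p) z ->
  chain delta (r + n + s) (loop r n v w p) z z.
Proof.
move=> delta0 r0 [v0 vr vT] [w0 ws wT].
have loop_w k : (r + n <= k)%N -> loop r n v w p k = w (k - (r + n))%N.
  by move=> rnk; rewrite /loop !ifF//; lia.
have loop_T k : (r <= k)%N -> (k <= r + n)%N ->
    loop r n v w p k = iter (k - r) T p.
  move=> rk; rewrite leq_eqVlt => /predU1P[->|krn].
    by rewrite loop_w// subnn w0 addKn.
  by rewrite /loop ifF ?krn//; lia.
have loop_v k : (k <= r)%N -> loop r n v w p k = v k.
  rewrite leq_eqVlt => /predU1P[->|kr]; last by rewrite /loop kr.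
  by rewrite loop_T ?leq_addr// subnn vr.
split; first by rewrite loop_v.
  by rewrite loop_w ?leq_addr// addKn.
move=> i iP; have [ir|ri] := ltnP i r.
  by rewrite !loop_v ?vT// ltnW.
have [irn|rni] := ltnP i (r + n).
  by rewrite !loop_T ?subSn ?mdistxx//; lia.
rewrite !loop_w ?subSn//; last by lia.
by apply: wT; lia.
Qed.

Lemma orbit_dist_periodic_ge (P : nat) (B : R) x y :
  (forall q, B <= orbit_dist T P (iter (q * P) T x) (iter (q * P) T y)) ->
  forall q, B *+ q <= orbit_dist T (q * P) x y.
Proof.
move=> BP; elim=> [|q IH]; first by rewrite mulr0n orbit_dist_ge0.
by rewrite mulrSr mulSn addnC orbit_dist_add lerD.
Qed.

(** Each turn around two loops with the same time schedule sees the orbit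
    segments of [a] and [b] of length [n] at the same times, up to the tracing
    error; the connecting parts contribute a non-negative amount. *)
Lemma traced_loops_orbit_dist (eps : R) (r n s : nat) (v w v' w' : nat -> X)
    (a b x y : X) : (0 < r + n + s)%N ->
  traced T eps (fun k => loop r n v w a (k %% (r + n + s))) x ->
  traced T eps (fun k => loop r n v' w' b (k %% (r + n + s))) y ->
  forall q, (orbit_dist T n a b - eps *+ 2 *+ n) *+ q <=
    orbit_dist T (q * (r + n + s)) x y.
Proof.
move=> P0 tx ty; apply: orbit_dist_periodic_ge => q.
set P := (r + n + s)%N in P0 tx ty *.
rewrite /P orbit_dist_add orbit_dist_add -addrA ler_wpDl ?orbit_dist_ge0//.
rewrite ler_wpDr ?orbit_dist_ge0// -!iterD.
rewrite lerBlDr -[_ *+ n in leRHS](_ : \sum_(i < n) eps *+ 2 = _); last first.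
  by rewrite sumr_const card_ord.
rewrite /orbit_dist -big_split/=; apply: ler_sum => i _.
have iE : ((i + (r + q * P)) %% P = r + i)%N.
  by rewrite addnA addnC modnMDl modn_small 1?addnC// /P; have := ltn_ord i; lia.
have := tx (i + (r + q * P))%N; rewrite iE loop_orbit// iterD => xa.
have := ty (i + (r + q * P))%N; rewrite iE loop_orbit// iterD => yb.
set x' := iter i T (iter (r + q * P) T x) in xa *.
set y' := iter i T (iter (r + q * P) T y) in yb *.
have h1 := metric_triangle (iter i T a) x' (iter i T b).
have := metric_triangle x' y' (iter i T b).
by move: h1; rewrite (metric_sym (iter i T a) x'); lra.
Qed.

(** Fix [U] and a point [z] in it.  For every point [p] there are chains of length
    at most [M] from [z] to [p] and from [T^n p] back to [z].  Colouring [p] with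
    these two lengths, [positive_entropy_mean_separated] gives [a] and [b] of the
    same colour whose segments of length [n > M] are far apart in mean.  The two
    closed pseudo-orbits through [z] then run with the same period
    [r + n + s <= 3 * n], and the points tracing them lie in [U]. *)
Lemma shadowing_mean_sensitive : compact [set: X] -> continuous T ->
  transitive_tds T -> shadowing T -> (0 < topological_entropy T)%E ->
  mean_sensitive T.
Proof.
move=> compactX cT trT shT hpos; apply: contrapT => nms.
have [d d0 sep] := positive_entropy_mean_separated compactX hpos.
(* Per period the traced orbits accumulate at least n * d / 2, against at most
   3 * n * (d / 12) = n * d / 4 if they were d / 12 close in mean. *)
have d120 : 0 < d / 12 by lra.
have [U [oU [z Uz] closeU]] := not_mean_sensitive nms d120.
have [e e0 eU] := open_mdist oU Uz.
pose eps := Num.min e (d / 4).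
have eps0 : 0 < eps by rewrite lt_min e0 divr_gt0.
have eps_e : eps <= e by rewrite ge_min lexx.
have eps_d : eps <= d / 4 by rewrite ge_min lexx orbT.
have [delta delta0 trace] := shT _ eps0.
have [M chainM] := transitive_chains compactX cT trT delta0.
have link (uv : X * X) : exists nw : 'I_M.+1 * (nat -> X),
    (0 < nw.1)%N /\ chain delta nw.1 nw.2 uv.1 uv.2.
  by have [n [w nw]] := chainM uv.1 uv.2; exists (n, w).
have [f fP] := choice link.
have [n Mn col] := sep ('I_M.+1 * 'I_M.+1)%type M.+1.
have [a [b [ab dab]]] := col (fun p => ((f (z, p)).1, (f (iter n T p, z)).1)).
case: ab => rab sab.
pose r : nat := (f (z, a)).1; pose s : nat := (f (iter n T a, z)).1.
have [r0 chain_za] := fP (z, a); have [s0 chain_az] := fP (iter n T a, z).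
have [_ chain_zb] := fP (z, b); have [_ chain_bz] := fP (iter n T b, z).
rewrite -rab in chain_zb; rewrite -sab in chain_bz.
rewrite -/r/= in r0 chain_za chain_zb; rewrite -/s/= in s0 chain_az chain_bz.
have rM : (r <= M)%N by rewrite -ltnS ltn_ord.
have sM : (s <= M)%N by rewrite -ltnS ltn_ord.
have P0 : (0 < r + n + s)%N by rewrite -addnA ltn_addr.
have loop_a := chain_loop delta0 r0 chain_za chain_az.
have loop_b := chain_loop delta0 r0 chain_zb chain_bz.
have [x tx] := trace _ (pseudo_orbit_periodic P0 loop_a).
have [y ty] := trace _ (pseudo_orbit_periodic P0 loop_b).
have traceU x' p v w : chain delta (r + n + s) (loop r n v w p) z z ->
    traced T eps (fun k => loop r n v w p (k %% (r + n + s))) x' -> U x'.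
  move=> [l0 _ _] /(_ 0%N) /=; rewrite mod0n l0 metric_sym => zx'.
  by apply: eU; exact: lt_le_trans eps_e.
have [N Nxy] := closeU _ _ (traceU _ _ _ _ loop_a tx) (traceU _ _ _ _ loop_b ty).
have := le_trans (traced_loops_orbit_dist P0 tx ty N.+1) (Nxy _ _).
move=> /(_ _); rewrite mulnC mulrnA lerMn2r/=.
have NP : (N <= (r + n + s) * N.+1)%N by rewrite (leq_trans (leqnSn N))// leq_pmull.
move=> /(_ NP); apply/negP; rewrite -ltNge.
have rsn : (r + n + s <= 3 * n)%N.
  by rewrite addnAC mulSnr leq_add2r mul2n -addnn leq_add// (leq_trans _ (ltnW Mn)).
have upper : (d / 12) *+ (r + n + s) <= d *+ n / 4.
  apply: (le_trans (ler_wpMn2l (ltW d120) rsn)).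
  by rewrite mulrnA mulrnAl ler_wMn2r// -mulr_natr; lra.
have slack : eps *+ 2 *+ n <= d *+ n / 2.
  by rewrite mulrnAl ler_wMn2r//; lra.
have dn0 : 0 < d *+ n by rewrite mulrn_wgt0// (leq_trans _ Mn).
clear -dab upper slack dn0; lra.
Qed.

End Shadowing.

(** * From a finitely additive probability to a Borel probability *)

Section Regularization.
Context {R : realType} {X : pointedMetricType R}.
Hypothesis compactX : compact [set: X].
Variable m : set X -> R.
Hypotheses (m_ge0 : forall A, 0 <= m A) (mT : m setT = 1).
Hypothesis mU : forall A B, A `&` B = set0 -> m (A `|` B) = m A + m B.

Let m0 : m set0 = 0.
Proof. by have := mU (setI0 set0); rewrite setU0; lra. Qed.

Let mD A B : A `<=` B -> m (B `\` A) = m B - m A.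
Proof.
move=> AB; rewrite -[in RHS](setDUK AB) mU ?setDIK//; lra.
Qed.

Let le_m A B : A `<=` B -> m A <= m B.
Proof. by move=> AB; have := m_ge0 (B `\` A); rewrite mD//; lra. Qed.

Let m_bigsetU (F : nat -> set X) n :
  m (\big[setU/set0]_(k < n) F k) <= \sum_(k < n) m (F k).
Proof.
elim: n => [|n IH]; first by rewrite !big_ord0 m0.
rewrite !big_ord_recr/=; set A := \big[_/_]_(_ < _) _ in IH *.
rewrite -[X in m X](setDUK (@subsetUl _ A (F n))) mU ?setDIK// lerD//.
by apply: le_m => x [[|//]] Ax /(_ Ax).
Qed.

(** The power set as a sigma-algebra: it gives access to the outer measure
    [mu_ext] of an arbitrary gauge, and the value [+oo] of [open_gauge] off the
    open sets then leaves only the covers by open sets. *)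
Definition all_subsets := g_sigma_algebraType [set: set X].

Definition open_gauge (A : set all_subsets) : \bar R :=
  if `[< open (A : set X) >] then (m A)%:E else +oo%E.

Definition open_outer : set X -> \bar R := mu_ext open_gauge.

Lemma open_gauge_ge0 A : (0 <= open_gauge A)%E.
Proof. by rewrite /open_gauge; case: asboolP; rewrite ?lee_fin ?leey. Qed.

Lemma measurable_all_subsets (A : set all_subsets) : measurable A.
Proof. exact: sub_gen_smallest. Qed.

Lemma open_outer_le (O : nat -> set X) (E : set X) (c : R) :
  (forall k, open (O k)) -> E `<=` \bigcup_k O k ->
  (forall n, \sum_(k < n) m (O k) <= c) -> (open_outer E <= c%:E)%E.
Proof.
move=> oO EO Oc; apply: ge_ereal_inf; exists (\sum_(k <oo) open_gauge (O k))%E.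
  by exists O => //; split => // k; exact: measurable_all_subsets.
apply: lime_le; first by apply: is_cvg_nneseries => n _ _; exact: open_gauge_ge0.
near=> n; rewrite big_mkord (eq_bigr (fun k : 'I_n => (m (O k))%:E)).
  by rewrite sumEFin lee_fin; exact: Oc.
by move=> k _; rewrite /open_gauge asboolT.
Unshelve. all: by end_near. Qed.

Lemma open_outer_ge (E : set X) (c : \bar R) :
  (forall O : nat -> set X, (forall k, open (O k)) -> E `<=` \bigcup_k O k ->
     (c <= \sum_(k <oo) (m (O k))%:E)%E) -> (c <= open_outer E)%E.
Proof.
move=> cO; apply: le_ereal_inf_tmp => _ [ O [_ EO] <-].
have [oO|/existsNP[k noO]] := pselect (forall k, open (O k : set X)).
  apply: le_trans (cO O oO EO) _; apply: lee_nneseries => [k _ _|k _].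
    by rewrite lee_fin.
  by rewrite /open_gauge asboolT.
rewrite (@eseries_pinfty _ _ _ k) ?leey//; last by rewrite /open_gauge asboolF.
by move=> i _; rewrite gt_eqF// (lt_le_trans _ (open_gauge_ge0 _))// ltNy0.
Qed.

Lemma open_outer_open (O : set X) : open O -> (open_outer O <= (m O)%:E)%E.
Proof.
move=> oO; apply: (@open_outer_le (fun k => if k is 0%N then O else set0)).
- by case=> // _; exact: open0.
- by move=> x Ox; exists 0%N.
case=> [|n]; first by rewrite big_ord0.
by rewrite big_ord_recl/= big1 ?addr0.
Qed.

(** This is where compactness enters: a countable open cover of a closed set has
    a finite subcover, to which finite subadditivity of [m] applies. *)
Lemma open_outer_closed (K : set X) : closed K -> ((m K)%:E <= open_outer K)%E.
Proof.
move=> cK; apply: open_outer_ge => O oO KO.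
have : compact K by exact: (subclosed_compact cK compactX).
rewrite compact_cover => /(_ _ setT O (fun k _ => oO k) KO)[D _ KD].
pose n := (\max_(k <- D) k).+1.
apply: (@le_trans _ _ (\sum_(0 <= k < n) (m (O k))%:E)%E); last first.
  by apply: nneseries_lim_ge => k _ _; rewrite lee_fin.
rewrite big_mkord sumEFin lee_fin (le_trans _ (m_bigsetU _ _))//.
apply: le_m => x /KD[k /= kD Okx]; rewrite -bigcup_mkord; exists k => //=.
by rewrite /n ltnS; exact: leq_bigmax_seq.
Qed.

Lemma open_outerT : open_outer setT = 1%E.
Proof.
apply/eqP; rewrite eq_le; apply/andP; split.
  by rewrite -mT; exact: open_outer_open openT.
by rewrite -mT; apply: open_outer_closed; exact: closedT.
Qed.

Lemma open_outer0 : open_outer set0 = 0%E.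
Proof.
apply: mu_ext0; last exact: open_gauge_ge0.
by rewrite /open_gauge asboolT ?m0//; exact: open0.
Qed.

Definition open_outer_measure : {outer_measure set X -> \bar R} :=
  HB.pack open_outer (isOuterMeasure.Build R X open_outer open_outer0
    (mu_ext_ge0 open_gauge_ge0) (@le_mu_ext _ all_subsets R open_gauge)
    (mu_ext_sigma_subadditive open_gauge_ge0)).

Lemma closed_exhaustion (W : set X) : open W -> exists K : nat -> set X,
  [/\ forall j, closed (K j), forall j, K j `<=` (K j.+1)^° & W = \bigcup_j K j].
Proof.
move=> oW; pose K j := [set x | forall y, ~ W y -> j.+1%:R^-1 <= mdist x y].
exists K; split=> [j|j x Kx|].
- rewrite -[K j]setCK; apply: open_closedC; rewrite openE => x /= /existsNP[y].
  move=> /not_implyP[nWy /negP]; rewrite -ltNge => xy.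
  apply/nbhs_ballP; exists (j.+1%:R^-1 - mdist x y); first by rewrite /= subr_gt0.
  move=> z /mdist_ballP xz /(_ _ nWy); apply/negP; rewrite -ltNge.
  by rewrite (le_lt_trans (metric_triangle z x y))// (metric_sym z x) -ltrBrDr.
- apply/nbhs_ballP; exists (j.+1%:R^-1 - j.+2%:R^-1).
    by rewrite /= subr_gt0 ltf_pV2 ?posrE// ltr_nat.
  move=> z /mdist_ballP xz y /Kx xy.
  move: xz xy (metric_triangle x z y).
  by move: (_.+1%:R^-1) (_.+2%:R^-1) => a b; lra.
- apply/seteqP; split=> [x Wx|x [j _ Kx]]; last first.
    apply: contrapT => /Kx; rewrite mdistxx; apply/negP.
    by rewrite -ltNge invr_gt0.
  have [e e0 eW] := open_mdist oW Wx.
  exists (Num.truncn e^-1) => // y nWy; apply: (@le_trans _ _ e); last first.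
    by rewrite leNgt; apply/negP => /eW.
  by rewrite invf_ple ?posrE// ltW// truncnS_gt.
Qed.

(** The sequence [m (K j)] is non-decreasing and bounded, hence almost constant
    from some [J] on.  Cover [W] by the interior of [K J.+1] and by the layers
    between [K j] and [K j.+2] for [j >= J]: the latter have total weight at
    most twice the oscillation of [m (K j)] beyond [J], by telescoping. *)
Lemma open_outer_inner_approx (W : set X) (e : R) : open W -> 0 < e ->
  exists K, [/\ closed K, K `<=` W & (open_outer W <= (m K + e)%:E)%E].
Proof.
move=> oW e0; have [K [cK KS WK]] := closed_exhaustion oW.
have KSs j : K j `<=` K j.+1 by move=> x /KS/interior_subset.
have Kmono i j : (i <= j)%N -> K i `<=` K j.
  move=> /subnKC <-; elim: (j - i)%N => [|k IH]; first by rewrite addn0.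
  by rewrite addnS; exact: subset_trans IH (KSs _).
have KW j : K j `<=` W by rewrite WK => x Kx; exists j.
have [J Jsup] : exists J, forall j, m (K j) <= m (K J) + e / 2.
  have supK : has_sup (range (m \o K)).
    split; first by exists (m (K 0%N)), 0%N.
    by exists 1 => _ [j _ <-]; rewrite -mT; exact: le_m.
  have e20 : 0 < e / 2 by lra.
  have [_ [J _ <-] hJ] := sup_adherent e20 supK; exists J => j.
  have : m (K j) <= sup (range (m \o K)) by apply: ub_le_sup; [case: supK|exists j].
  by move: hJ => /=; lra.
exists (K J.+1); split=> //.
pose V k := if k is k'.+1 then (K (J + k').+2)^° `\` K (J + k')%N else (K J.+1)^°.
apply: (@open_outer_le V) => [[|k]|x|n].
- exact: open_interior.
- by rewrite /V setDE; apply: openI; [exact: open_interior|exact: closed_openC].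
- rewrite WK => -[j _]; elim: j => [|j IH] Kx.
    by exists 0%N => //=; apply: KS; exact: Kmono Kx.
  have [/IH//|nKx] := pselect (K j x).
  have [jJ|Jj] := ltnP j J; first by exists 0%N => //=; apply: KS; exact: Kmono Kx.
  by exists (j - J).+1 => //=; rewrite subnKC//; split=> //; exact: KS.
case: n => [|n]; first by rewrite big_ord0 addr_ge0// ltW.
rewrite big_ord_recl/= lerD ?le_m//; first exact: interior_subset.
apply: (@le_trans _ _
    (m (K (J + n).+1) + m (K (J + n)%N) - m (K J.+1) - m (K J))); last first.
  by have := Jsup (J + n).+1; have := Jsup (J + n)%N; have := le_m (KSs J); lra.
elim: n => [|n IH]; first by rewrite big_ord0 addn0; lra.
rewrite big_ord_recr/= addnS.
have : m ((K (J + n).+2)^° `\` K (J + n)%N) <= m (K (J + n).+2) - m (K (J + n)%N).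
  rewrite -mD; first by apply: le_m; apply: setSD; exact: interior_subset.
  exact: subset_trans (KSs _) (KSs _).
by move: IH; lra.
Qed.

(** With [K] closed inside [V `&` G] and almost exhausting it, [V `\` K] is an
    open set around [V `\` G], and [m] is additive on [K] and [V `\` K]. *)
Lemma open_outer_split (V G : set X) : open V -> open G ->
  (open_outer (V `&` G) + open_outer (V `\` G) <= (m V)%:E)%E.
Proof.
move=> oV oG; apply/lee_addgt0Pr => e e0.
have [K [cK KVG outK]] := open_outer_inner_approx (openI oV oG) e0.
have KV : K `<=` V by move=> x /KVG[].
have outVK : (open_outer (V `\` G) <= (m V - m K)%:E)%E.
  rewrite -mD//; apply: le_trans (open_outer_open _).
    by apply: le_mu_ext => x [Vx nGx]; split=> // /KVG[].
  by rewrite setDE; apply: openI => //; exact: closed_openC.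
apply: le_trans (leeD outK outVK) _.
by rewrite -!EFinD lee_fin; lra.
Qed.

(** An open cover of a set restricts to covers of its parts inside and outside
    [G], so it suffices to split each open set of the cover. *)
Lemma caratheodory_open (G : set X) :
  open G -> open_outer_measure.-caratheodory G.
Proof.
move=> oG; apply: le_caratheodory_measurable => E; apply: open_outer_ge => V oV EV.
have outer_cover (B : set X) :
    (open_outer (E `&` B) <= \sum_(k <oo) open_outer (V k `&` B))%E.
  apply: le_trans (mu_ext_sigma_subadditive open_gauge_ge0 _).
  by apply: le_mu_ext => x [/EV[k _ Vx] Bx]; exists k.
apply: le_trans (leeD (outer_cover _) (outer_cover _)) _.
rewrite -nneseriesD; last 2 first.
- by move=> k _ _; exact: (mu_ext_ge0 open_gauge_ge0).
- by move=> k _ _; exact: (mu_ext_ge0 open_gauge_ge0).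
apply: lee_nneseries => k _.
  by move=> _; rewrite adde_ge0 ?(mu_ext_ge0 open_gauge_ge0).
by rewrite -setDE; exact: open_outer_split.
Qed.

Lemma caratheodory_borel (A : set (borel X)) :
  measurable A -> open_outer_measure.-caratheodory A.
Proof.
apply: smallest_sub; last exact: caratheodory_open.
split.
- exact: caratheodory_measurable_set0.
- by move=> B mB; rewrite setTD; exact: caratheodory_measurable_setC.
- by move=> F mF; exact: caratheodory_measurable_bigcup.
Qed.

Lemma open_outer_sigma_additive :
  semi_sigma_additive (open_outer : set (borel X) -> \bar R).
Proof.
move=> F mF tF mUF.
apply: (@caratheodory_measure_sigma_additive R X open_outer_measure F) => //.
- by move=> k; exact: caratheodory_borel.
- exact: caratheodory_borel.
Qed.

Definition borel_regularization_measure : {measure set (borel X) -> \bar R} :=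
  HB.pack (open_outer : set (borel X) -> \bar R)
    (isMeasure.Build _ (borel X) R open_outer
      open_outer0 (mu_ext_ge0 open_gauge_ge0) open_outer_sigma_additive).

Definition borel_regularization : probability (borel X) R :=
  HB.pack (open_outer : set (borel X) -> \bar R) borel_regularization_measure
    (Measure_isProbability.Build _ (borel X) R borel_regularization_measure
      open_outerT).

(** Pulling back open covers gives one inequality for all sets; applied to a
    set and to its complement it gives the equality. *)
Lemma borel_regularization_invariant (T : X -> X) : continuous T ->
  (forall A, m (T @^-1` A) = m A) -> invariant_measure T borel_regularization.
Proof.
move=> cT mTA.
have le_preimage (A : set X) : (open_outer (T @^-1` A) <= open_outer A)%E.
  apply: open_outer_ge => V oV AV.
  apply: (@le_trans _ _ (\sum_(k <oo) open_outer (T @^-1` V k))%E).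
    apply: le_trans (mu_ext_sigma_subadditive open_gauge_ge0 _).
    by apply: le_mu_ext => x /AV[k _ Vx]; exists k.
  apply: lee_nneseries => k _; first by move=> _; exact: (mu_ext_ge0 open_gauge_ge0).
  rewrite -mTA; apply: open_outer_open; apply: open_comp => // x _; exact: cT.
move=> A mA; apply/eqP; rewrite eq_le le_preimage/=.
have sub1 : (1 <= open_outer (T @^-1` A) + open_outer (T @^-1` (~` A)))%E.
  rewrite -open_outerT -(preimage_setT T) -(setUv A) preimage_setU.
  exact: (outer_measureU2 open_outer_measure).
have := le_trans sub1 (leeD2l _ (le_preimage (~` A))).
have -> : open_outer (~` A) = (1 - open_outer A)%E :=
  probability_setC borel_regularization mA.
have [r ->] : exists r, open_outer A = r%:E.
  exists (fine (borel_regularization A)); rewrite fineK//.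
  exact: fin_num_measure.
case: (open_outer (T @^-1` A)) => [x| |]//=; rewrite ?leey//.
by rewrite -EFinB -EFinD !lee_fin; lra.
Qed.

End Regularization.

(** * Limits of empirical measures along an ultrafilter *)

Section EmpiricalMeasures.
Context {R : realType} {X : pointedMetricType R}.
Variables (T : X -> X) (U : set_system nat).
Context {UU : UltraFilter U}.

Lemma bounded_ultra_cvg (f : nat -> R) :
  (forall n, 0 <= f n <= 1) -> cvg (f n @[n --> U]).
Proof.
move=> f01.
have U01 : U (f @^-1` `[0, 1]) by apply: filterE => n; rewrite /= in_itv/= f01.
have [l [_ fl]] := @segment_compact R 0 1 (f n @[n --> U]) _ U01.
apply/cvg_ex; exists l => V Vl.
have [//|UnV] := in_ultra_setVsetC (f @^-1` V) UU.
by have [x []] := fl (~` V) V UnV Vl.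
Qed.

Variables (a : nat -> X) (len : nat -> nat).
Hypothesis len_gt : forall N, (N < len N)%N.

Definition frequency (N : nat) (A : set X) : R :=
  (len N)%:R^-1 * \sum_(i < len N) \1_A (iter i T (a N)).

(** The limit along an ultrafilter exists for all sets simultaneously, so it is
    finitely additive on the whole power set. *)
Definition limit_frequency (A : set X) : R := lim (frequency N A @[N --> U]).

Let len_gt0 N : 0 < (len N)%:R :> R.
Proof. by rewrite ltr0n (leq_ltn_trans _ (len_gt N)). Qed.

Lemma frequency_ge0 N A : 0 <= frequency N A.
Proof. by rewrite mulr_ge0 ?invr_ge0 ?ler0n// sumr_ge0// => i _; rewrite indicE. Qed.

Lemma frequency_le1 N A : frequency N A <= 1.
Proof.
rewrite ler_pdivrMl// mulr1 -[leRHS](_ : \sum_(i < len N) 1 = _).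
  by apply: ler_sum => i _; rewrite indicE lern1 leq_b1.
by rewrite sumr_const card_ord.
Qed.

Lemma frequencyT N : frequency N setT = 1.
Proof.
rewrite /frequency (eq_bigr (fun=> 1)); last by move=> i _; rewrite indicT.
by rewrite sumr_const card_ord mulVf ?gt_eqF.
Qed.

Lemma frequencyU N A B : A `&` B = set0 ->
  frequency N (A `|` B) = frequency N A + frequency N B.
Proof.
move=> AB; rewrite /frequency -mulrDr -big_split/=; congr (_ * _).
apply: eq_bigr => i _; rewrite !indicE in_setU.
have [xA|_] := boolP (_ \in A); last by rewrite add0r.
have [xB|_] := boolP (_ \in B); last by rewrite addr0.
rewrite !inE in xA xB.
by have : (A `&` B) (iter i T (a N)) by []; rewrite AB.
Qed.

(** The two sums over the orbit segment differ only in their end terms. *)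
Lemma frequency_preimage N A :
  `|frequency N (T @^-1` A) - frequency N A| <= (len N)%:R^-1.
Proof.
rewrite /frequency -mulrBr normrM gtr0_norm ?invr_gt0// ler_piMr ?invr_ge0 ?ler0n//.
rewrite -sumrB (eq_bigr (fun i : 'I_(len N) =>
  \1_A (iter i.+1 T (a N)) - \1_A (iter i T (a N)))); last by [].
rewrite -(big_mkord xpredT (fun i => \1_A (iter i.+1 T (a N)) - \1_A (iter i T (a N)))).
rewrite telescope_sumr// !indicE.
by case: (_ \in A); case: (_ \in A); rewrite ?subrr ?normr0 ?subr0 ?normr1 ?sub0r ?normrN1.
Qed.

Lemma cvg_frequency A : frequency N A @[N --> U] --> limit_frequency A.
Proof. by apply: bounded_ultra_cvg => N; rewrite frequency_ge0 frequency_le1. Qed.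

Lemma limit_frequency_ge (c : R) A :
  (forall N, c <= frequency N A) -> c <= limit_frequency A.
Proof.
by move=> cA; apply: (cvgr_to_ge (@cvg_frequency A)); exact: filterE.
Qed.

Lemma limit_frequencyT : limit_frequency setT = 1.
Proof.
rewrite /limit_frequency (_ : (fun N => _) = fun=> 1); last first.
  by apply/funext => N; rewrite frequencyT.
by apply: cvg_lim => //; exact: cvg_cst.
Qed.

Lemma limit_frequencyU A B : A `&` B = set0 ->
  limit_frequency (A `|` B) = limit_frequency A + limit_frequency B.
Proof.
move=> AB; apply: cvg_lim => //.
rewrite (_ : (fun N => _) = (fun N => frequency N A + frequency N B)).
  by apply: cvgD; exact: cvg_frequency.
by apply/funext => N; rewrite frequencyU.
Qed.

Lemma limit_frequency_preimage A : \oo `<=` U ->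
  limit_frequency (T @^-1` A) = limit_frequency A.
Proof.
move=> ooU; apply: cvg_lim => //.
rewrite (_ : (fun N => _) = (fun N =>
  (frequency N (T @^-1` A) - frequency N A) + frequency N A)); last first.
  by apply/funext => N; rewrite subrK.
rewrite -[X in _ --> X]add0r; apply: cvgD; last exact: cvg_frequency.
apply: norm_cvg0.
apply: (@squeeze_cvgr _ _ _ _ (cst 0) (fun N => N.+1%:R^-1)).
- apply: filterS filterT => N _; rewrite normr_ge0 (le_trans (frequency_preimage _ _))//.
  by rewrite lef_pV2 ?posrE// ler_nat.
- exact: cvg_cst.
- move=> V V0; apply: ooU; exact: (@cvg_harmonic R).
Qed.

End EmpiricalMeasures.

(** * Uniquely ergodic mixing systems *)

Section UniquelyErgodic.
Context {R : realType} {X : pointedMetricType R}.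
Variable T : X -> X.
Hypotheses (compactX : compact [set: X]) (continuousT : continuous T).

Lemma compact_mdist_bounded (p : X) : exists2 D : R, 0 < D & forall x, mdist x p <= D.
Proof.
have [K [c net]] := finite_net compactX ltr01.
exists (\sum_i mdist (c i) p + 1).
  by rewrite ltr_wpDl// sumr_ge0// => i _; exact: mdist_ge0.
move=> x; have [i ix] := net x; rewrite (bigD1 i)//=.
have := metric_triangle x (c i) p; rewrite (metric_sym x (c i)).
have : 0 <= \sum_(j < K | j != i) mdist (c j) p.
  by rewrite sumr_ge0// => j _; exact: mdist_ge0.
by move: ix; lra.
Qed.

(** A Krylov-Bogolyubov argument: the limit of the empirical measures of the given
    orbit segments is invariant.  As [mdist _ p] is bounded by some [D], a mean of
    at least [c] forces every segment to spend a proportion of at least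
    [c / (2 * D)] of its time at distance at least [c / 2] from [p].  This set is
    closed, so the limit measure does not lose its mass. *)
Lemma exists_invariant_measure_away (p : X) (c : R) : 0 < c ->
  (forall N, exists2 n, (N < n)%N & exists y,
     c *+ n <= \sum_(i < n) mdist (iter i T y) p) ->
  exists2 nu : probability (borel X) R, invariant_measure T nu &
    (0 < nu [set x | c / 2 <= mdist x p]%R)%E.
Proof.
move=> c0 far.
have far' N : exists ny : nat * X, (N < ny.1)%N /\
    c *+ ny.1 <= \sum_(i < ny.1) mdist (iter i T ny.2) p.
  by have [n Nn [y ny]] := far N; exists (n, y).
have [f fP] := choice far'.
pose len N := (f N).1; pose a N := (f N).2.
have len_gt N : (N < len N)%N by have [] := fP N.
have [U [UU ooU]] := ultraFilterLemma (eventually_filter : ProperFilter \oo).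
pose m := limit_frequency T U a len.
have m_ge0 A : 0 <= m A by apply: limit_frequency_ge => // N; exact: frequency_ge0.
have mT : m setT = 1 by exact: limit_frequencyT.
have mU A B : A `&` B = set0 -> m (A `|` B) = m A + m B by exact: limit_frequencyU.
pose nu := borel_regularization compactX m_ge0 mT mU.
exists nu.
  apply: borel_regularization_invariant => // A; exact: limit_frequency_preimage.
set B := [set x | _].
have cB : closed B by exact: closed_mdist_ge.
have nuB : ((m B)%:E <= nu B)%E by exact: open_outer_closed.
apply: lt_le_trans nuB.
have [D D0 DX] := compact_mdist_bounded p.
rewrite lte_fin (@lt_le_trans _ _ (c / (2 * D)))//.
  by rewrite divr_gt0// mulr_gt0.
apply: limit_frequency_ge => // N; have [_ cN] := fP N.
have len0 : 0 < (len N)%:R :> R by rewrite ltr0n (leq_ltn_trans _ (len_gt N)).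
rewrite /frequency ler_pdivlMl// mulrA ler_pdivrMr ?mulr_gt0//.
have upper : \sum_(i < len N) mdist (iter i T (a N)) p <=
    \sum_(i < len N) (D * \1_B (iter i T (a N)) + c / 2).
  apply: ler_sum => i _; rewrite indicE; case: (boolP (_ \in B)) => xB.
    by rewrite mulr1 ler_wpDr ?DX// ltW// divr_gt0.
  by move: xB; rewrite notin_setE /B/= => /negP; rewrite -ltNge mulr0 add0r => /ltW.
have {cN upper} := le_trans cN upper.
rewrite big_split/= -mulr_sumr sumr_const card_ord -lerBlDr -mulrnBl.
rewrite -[X in X *+ _](_ : c / 2 = _); last by lra.
rewrite -[_ *+ (f N).1]mulr_natl.
have double (n u : R) : n * (c / 2) <= D * u -> n * c <= u * (2 * D).
  by clear; lra.
exact: double.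
Qed.

(** Otherwise there is a fixed point [p], and unique ergodicity leaves the Dirac
    mass at [p] as the only invariant measure.  But positive entropy gives
    arbitrarily long orbit segments of two points at mean distance more than [d];
    one of the two segments is at mean distance at least [d / 2] from [p], and
    such segments produce an invariant measure that charges the complement
    of [p]. *)
Lemma uniquely_ergodic_mean_sensitive : topologically_mixing T ->
  uniquely_ergodic T -> (0 < topological_entropy T)%E -> mean_sensitive T.
Proof.
move=> mixT [mu inv_mu uniq_mu] hpos; apply: contrapT => nms.
have [p Tp] := fixed_point_of_not_mean_sensitive compactX continuousT
  (mixing_hits mixT) nms.
have iterp n : iter n T p = p by elim: n => //= n ->.
have [d d0 sep] := positive_entropy_mean_separated compactX hpos.
have [|N|nu inv_nu nu_far] := @exists_invariant_measure_away p (d / 2).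
- by rewrite divr_gt0.
- have [n Nn sepn] := sep unit N.+1; exists n => //.
  have [x [y [_ xy]]] := sepn (fun=> tt).
  have orbp z : orbit_dist T n z p = \sum_(i < n) mdist (iter i T z) p.
    by apply: eq_bigr => i _; rewrite iterp.
  have := orbit_dist_triangle T n x p y; rewrite (orbit_dist_sym T n p y) !orbp.
  have dn : d *+ n = d / 2 *+ n + d / 2 *+ n by rewrite -mulrnDl -splitr.
  have [hx|hx] := leP (d / 2 *+ n) (\sum_(i < n) mdist (iter i T x) p).
    by exists x.
  by exists y; lra.
set B := [set x | _] in nu_far.
have mB : measurable (B : set (borel X)).
  rewrite -[B]setCK; apply: measurableC; apply: sub_gen_smallest.
  by apply: closed_openC; exact: closed_mdist_ge.
have inv_dirac : invariant_measure T (dirac (p : borel X) : probability (borel X) R).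
  move=> A _; have pA : (p \in T @^-1` A) = (p \in A).
    by apply/idP/idP; rewrite !inE /= Tp.
  by rewrite /= /dirac !indicE pA.
move: nu_far; rewrite (uniq_mu _ inv_nu _ mB) -(uniq_mu _ inv_dirac _ mB)/=.
rewrite /dirac indicE memNset ?ltxx// /B/= mdistxx; apply/negP.
by rewrite -ltNge !divr_gt0.
Qed.

End UniquelyErgodic.

Unset Implicit Arguments.

Theorem theorem1p5 (R : realType) (X : pointedMetricType R) (T : X -> X)
    (compactX : compact [set: X]) (continuousT : continuous T) :
  (topologically_mixing T -> uniquely_ergodic T ->
     (0 < topological_entropy T)%E -> mean_sensitive T) /\
  ((exists x y : X, x <> y) -> minimal_tds T -> weakly_mixing T ->
     mean_sensitive T) /\
  (transitive_tds T -> shadowing T -> (0 < topological_entropy T)%E ->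
     mean_sensitive T).
Proof.
split; [|split].
- exact: uniquely_ergodic_mean_sensitive.
- exact: minimal_weakly_mixing_mean_sensitive.
- exact: shadowing_mean_sensitive.
Qed.
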